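(* Let $(\mathcal B,\mathbb E,\mathfrak s)$ be an extriangulated category. For any cotorsion pair $(\mathcal U,\mathcal V)$ on $\mathcal B$, its heart $\underline{\mathcal H}$ is an abelian category.
   Context: Extriangulated category $(\mathcal B,\mathbb E,\mathfrak s)$: (ET1) $\mathcal B$ is an additive category and $\mathbb E\colon\mathcal B^{\mathrm{op}}\times\mathcal B\to \mathrm{Ab}$ is an additive bifunctor; for $\delta\in\mathbb E(C,A)$, $a\colon A\to A'$, $c\colon C'\to C$ write $a_*\delta=\mathbb E(C,a)(\delta)$ and $c^*\delta=\mathbb E(c,A)(\delta)$. Sequences $A\to B\to C$ and $A\to B'\to C$ are equivalent if there is an isomorphism $B\cong B'$ compatible with the identities of $A$ and $C$. $\mathfrak s$ assigns to each $\delta\in\mathbb E(C,A)$ an equivalence class $\mathfrak s(\delta)=[A\xrightarrow{x}B\xrightarrow{y}C]$; we say $A\xrightarrow{x}B\xrightarrow{y}C$ realizes $\delta$. (ET2) $\mathfrak s$ is an additive realization: if $A\xrightarrow{x}B\xrightarrow{y}C$ realizes $\delta$, $A'\xrightarrow{x'}B'\xrightarrow{y'}C'$ realizes $\delta'$ and $a\colon A\to A'$, $c\colon C\to C'$ satisfy $a_*\delta=c^*\delta'$, then there is $b\colon B\to B'$ with $bx=x'a$, $y'b=cy$; $0\in\mathbb E(C,A)$ is realized by the split sequence $A\to A\oplus C\to C$; and $\mathfrak s(\delta\oplus\delta')=\mathfrak s(\delta)\oplus\mathfrak s(\delta')$. (ET3) If $A\xrightarrow{x}B\xrightarrow{y}C$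 realizes $\delta\in\mathbb E(C,A)$, $A'\xrightarrow{x'}B'\xrightarrow{y'}C'$ realizes $\delta'\in\mathbb E(C',A')$ and $a\colon A\to A'$, $b\colon B\to B'$ satisfy $bx=x'a$, then there is $c\colon C\to C'$ with $cy=y'b$ and $a_*\delta=c^*\delta'$; and (ET3)$^{\mathrm{op}}$, its dual. (ET4) If $\delta\in\mathbb E(D,A)$ and $\delta'\in\mathbb E(F,B)$ are realized by $A\xrightarrow{f}B\xrightarrow{f'}D$ and $B\xrightarrow{g}C\xrightarrow{g'}F$, there are an object $E$, morphisms $d\colon D\to E$, $e\colon E\to F$, $h'\colon C\to E$ with $h'g=df'$, $eh'=g'$, and $\delta''\in\mathbb E(E,A)$ realized by $A\xrightarrow{gf}C\xrightarrow{h'}E$, such that $D\xrightarrow{d}E\xrightarrow{e}F$ realizes $f'_*\delta'$, $d^*\delta''=\delta$ and $f_*\delta''=e^*\delta'$; and (ET4)$^{\mathrm{op}}$, its dual. A conflation $A\rightarrowtail B\twoheadrightarrow C$ is a sequence realizing some $\delta\in\mathbb E(C,A)$. For full subcategories $\mathcal X,\mathcal Y\subseteq\mathcal B$: $\mathrm{Cone}(\mathcal X,\mathcal Y)$ is the full subcategory of objects $B$ admitting a conflation $X\rightarrowtail Y\twoheadrightarrow B$, and $\mathrm{CoCone}(\mathcal X,\mathcal Y)$ that of objects $B$ admitting a conflation $B\rightarrowtail X\twoheadrightarrow Y$, with $X\in\mathcal X$, $Y\in\mathcal Y$. A cotorsion pair $(\mathcal U,\mathcal V)$ on $\mathcal B$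 is a pair of full additive subcategories closed under direct summands and isomorphisms with $\mathbb E(\mathcal U,\mathcal V)=0$ and such that every $B\in\mathcal B$ admits conflations $V_B\rightarrowtail U_B\twoheadrightarrow B$ and $B\rightarrowtail V^B\twoheadrightarrow U^B$ with $U_B,U^B\in\mathcal U$, $V_B,V^B\in\mathcal V$. Put $\mathcal W=\mathcal U\cap\mathcal V$, $\mathcal B^+=\mathrm{Cone}(\mathcal V,\mathcal W)$, $\mathcal B^-=\mathrm{CoCone}(\mathcal W,\mathcal U)$, $\mathcal H=\mathcal B^+\cap\mathcal B^-$. The heart is $\underline{\mathcal H}=\mathcal H/\mathcal W$ (ideal quotient by morphisms factoring through objects of $\mathcal W$). *)

(* Defs.v *)
From HB Require Import structures.
From mathcomp Require Import all_boot all_algebra.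
From mathcomp Require Import boolp.

Set Implicit Arguments.
Unset Strict Implicit.
Unset Printing Implicit Defensive.

Import GRing.Theory.
Local Open Scope ring_scope.
Local Open Scope quotient_scope.

Declare Scope cat_scope.
Delimit Scope cat_scope with cat.
Local Open Scope cat_scope.

(** * Preadditive, additive and abelian categories *)

(** Hom-groups are [zmodType]s. The choice and decidable-equality structures
    this includes are no restriction, since [boolp] supplies them for any type. *)
Record preadditive : Type := Preadditive {
  obj :> Type;
  hom : obj -> obj -> zmodType;
  idm : forall A, hom A A;
  mcomp : forall A B C, hom B C -> hom A B -> hom A C;
  mcompA : forall A B C D (h : hom C D) (g : hom B C) (f : hom A B),
    mcomp h (mcomp g f) = mcomp (mcomp h g) f;
  mcomp1m : forall A B (f : hom A B), mcomp (idm B) f = f;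
  mcompm1 : forall A B (f : hom A B), mcomp f (idm A) = f;
  mcompDl : forall A B C (g g' : hom B C) (f : hom A B),
    mcomp (g + g') f = mcomp g f + mcomp g' f;
  mcompDr : forall A B C (g : hom B C) (f f' : hom A B),
    mcomp g (f + f') = mcomp g f + mcomp g f' }.

Arguments hom {p} A B.
Arguments idm {p} A.
Arguments mcomp {p A B C} g f.

Notation "g ∘ f" := (mcomp g f) (at level 40, left associativity) : cat_scope.

Lemma mcomp0m (C : preadditive) (X Y Z : C) (f : hom X Y) :
  (0 : hom Y Z) ∘ f = 0.
Proof. by apply: (addIr (0 ∘ f)); rewrite -mcompDl !add0r. Qed.

Lemma mcompm0 (C : preadditive) (X Y Z : C) (g : hom Y Z) :
  g ∘ (0 : hom X Y) = 0.
Proof. by apply: (addIr (g ∘ 0)); rewrite -mcompDr !add0r. Qed.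

Lemma mcompNl (C : preadditive) (X Y Z : C) (g : hom Y Z) (f : hom X Y) :
  (- g) ∘ f = - (g ∘ f).
Proof. by apply: (addIr (g ∘ f)); rewrite -mcompDl !addNr mcomp0m. Qed.

Lemma mcompNr (C : preadditive) (X Y Z : C) (g : hom Y Z) (f : hom X Y) :
  g ∘ (- f) = - (g ∘ f).
Proof. by apply: (addIr (g ∘ f)); rewrite -mcompDr !addNr mcompm0. Qed.

Section CategoryNotions.
Variable C : preadditive.

Definition is_iso (A B : C) (f : hom A B) : Prop :=
  exists g : hom B A, g ∘ f = idm A /\ f ∘ g = idm B.

Definition isomorphic (A B : C) : Prop := exists f : hom A B, is_iso f.

Definition is_zero_object (Z : C) : Prop :=
  forall X : C, (forall f : hom Z X, f = 0) /\ (forall f : hom X Z, f = 0).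

Record biproduct (A B : C) : Type := Biproduct {
  bp_obj :> C;
  inj1 : hom A bp_obj;
  inj2 : hom B bp_obj;
  prj1 : hom bp_obj A;
  prj2 : hom bp_obj B;
  prj1_inj1 : prj1 ∘ inj1 = idm A;
  prj2_inj2 : prj2 ∘ inj2 = idm B;
  prj1_inj2 : prj1 ∘ inj2 = 0;
  prj2_inj1 : prj2 ∘ inj1 = 0;
  inj_prjD : inj1 ∘ prj1 + inj2 ∘ prj2 = idm bp_obj }.

Definition bp_map (A B A' B' : C) (P : biproduct A B) (P' : biproduct A' B')
    (f : hom A A') (g : hom B B') : hom P P' :=
  inj1 P' ∘ f ∘ prj1 P + inj2 P' ∘ g ∘ prj2 P.

Definition additive_category : Prop :=
  (exists Z : C, is_zero_object Z) /\
  (forall A B : C, inhabited (biproduct A B)).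

Definition mono (A B : C) (f : hom A B) : Prop :=
  forall (X : C) (g h : hom X A), f ∘ g = f ∘ h -> g = h.

Definition epi (A B : C) (f : hom A B) : Prop :=
  forall (X : C) (g h : hom B X), g ∘ f = h ∘ f -> g = h.

Definition is_kernel (A B K : C) (f : hom A B) (k : hom K A) : Prop :=
  f ∘ k = 0 /\
  forall (X : C) (g : hom X A), f ∘ g = 0 -> exists! u : hom X K, k ∘ u = g.

Definition is_cokernel (A B Q : C) (f : hom A B) (q : hom B Q) : Prop :=
  q ∘ f = 0 /\
  forall (X : C) (g : hom B X), g ∘ f = 0 -> exists! u : hom Q X, u ∘ q = g.

Definition abelian_category : Prop :=
  [/\ additive_category,
      forall (A B : C) (f : hom A B), exists (K : C) (k : hom K A), is_kernel f k,
      forall (A B : C) (f : hom A B), exists (Q : C) (q : hom B Q), is_cokernel f q,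
      forall (A B : C) (f : hom A B), mono f ->
        exists (D : C) (g : hom B D), is_kernel g f
    & forall (A B : C) (f : hom A B), epi f ->
        exists (D : C) (g : hom D A), is_cokernel g f].

(** Full subcategories are given by predicates on objects. *)
Record additive_subcategory (P : C -> Prop) : Prop := AdditiveSubcategory {
  sub_zero : exists2 Z : C, is_zero_object Z & P Z;
  sub_sum : forall (A B : C) (S : biproduct A B), P A -> P B -> P S }.

Definition iso_closed (P : C -> Prop) : Prop :=
  forall A B : C, isomorphic A B -> P A -> P B.

Definition summand_closed (P : C -> Prop) : Prop :=
  forall (A B : C) (S : biproduct A B), P S -> P A /\ P B.

End CategoryNotions.

(** * Full subcategories *)

Definition full_subcategory (C : preadditive) (P : C -> Prop) : preadditive :=
  @Preadditive {A : C | P A}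
    (fun A B => hom (sval A) (sval B))
    (fun A => idm (sval A))
    (fun A B D g f => g ∘ f)
    (fun A B D E h g f => mcompA h g f)
    (fun A B f => mcomp1m f)
    (fun A B f => mcompm1 f)
    (fun A B D g g' f => mcompDl g g' f)
    (fun A B D g f f' => mcompDr g f f').

(** * Ideal quotients *)

Record ideal (C : preadditive) : Type := Ideal {
  ideal_mem :> forall A B : C, zmodClosed (hom A B);
  idealMl : forall (A B D : C) (g : hom B D) (f : hom A B),
    f \in ideal_mem A B -> g ∘ f \in ideal_mem A D;
  idealMr : forall (A B D : C) (g : hom B D) (f : hom A B),
    g \in ideal_mem B D -> g ∘ f \in ideal_mem A D }.

Section IdealQuotient.
Variables (C : preadditive) (I : ideal C).

Definition qhom (A B : C) : zmodType := Quotient.quot (I A B).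

Definition qclass (A B : C) (f : hom A B) : qhom A B := \pi f.

Lemma qclass_eq (A B : C) (f g : hom A B) :
  qclass f = qclass g <-> f - g \in I A B.
Proof.
rewrite Quotient.idealrBE; split=> [e|/eqP //].
by apply/eqP.
Qed.

Lemma qclass_repr (A B : C) (f : qhom A B) : qclass (repr f) = f.
Proof. exact: reprK. Qed.

Lemma qclassD (A B : C) (f g : hom A B) : qclass (f + g) = qclass f + qclass g.
Proof. exact: Quotient.pi_add. Qed.

Definition qcomp (A B D : C) (g : qhom B D) (f : qhom A B) : qhom A D :=
  qclass (repr g ∘ repr f).

Lemma qcompE (A B D : C) (g : hom B D) (f : hom A B) :
  qcomp (qclass g) (qclass f) = qclass (g ∘ f).
Proof.
apply/qclass_eq; set g' := repr _; set f' := repr _.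
have Ig : g' - g \in I B D by apply/qclass_eq; rewrite qclass_repr.
have If : f' - f \in I A B by apply/qclass_eq; rewrite qclass_repr.
have -> : g' ∘ f' - g ∘ f = g' ∘ (f' - f) + (g' - g) ∘ f.
  by rewrite mcompDr mcompDl mcompNr mcompNl addrA addrNK.
by apply: rpredD; [apply: idealMl | apply: idealMr].
Qed.

Lemma qcompA (A B D E : C) (h : qhom D E) (g : qhom B D) (f : qhom A B) :
  qcomp h (qcomp g f) = qcomp (qcomp h g) f.
Proof.
by rewrite -(qclass_repr h) -(qclass_repr g) -(qclass_repr f) !qcompE mcompA.
Qed.

Lemma qcomp1m (A B : C) (f : qhom A B) : qcomp (qclass (idm B)) f = f.
Proof. by rewrite -(qclass_repr f) qcompE mcomp1m. Qed.

Lemma qcompm1 (A B : C) (f : qhom A B) : qcomp f (qclass (idm A)) = f.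
Proof. by rewrite -(qclass_repr f) qcompE mcompm1. Qed.

Lemma qcompDl (A B D : C) (g g' : qhom B D) (f : qhom A B) :
  qcomp (g + g') f = qcomp g f + qcomp g' f.
Proof.
rewrite -(qclass_repr g) -(qclass_repr g') -(qclass_repr f).
by rewrite -qclassD !qcompE mcompDl qclassD.
Qed.

Lemma qcompDr (A B D : C) (g : qhom B D) (f f' : qhom A B) :
  qcomp g (f + f') = qcomp g f + qcomp g f'.
Proof.
rewrite -(qclass_repr g) -(qclass_repr f) -(qclass_repr f').
by rewrite -qclassD !qcompE mcompDr qclassD.
Qed.

Definition ideal_quotient : preadditive :=
  @Preadditive C qhom (fun A => qclass (idm A)) qcomp
    qcompA qcomp1m qcompm1 qcompDl qcompDr.

End IdealQuotient.

(** * The ideal of morphisms factoring through a subcategory *)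

Definition factors_through (C : preadditive) (W : C -> Prop) (A B : C)
    (f : hom A B) : Prop :=
  exists (X : C) (g : hom A X) (h : hom X B), W X /\ f = h ∘ g.

(** What makes the morphisms factoring through [W] closed under sums. *)
Definition has_sums (C : preadditive) (W : C -> Prop) : Prop :=
  (exists X, W X) /\
  (forall X Y, W X -> W Y -> exists S : biproduct X Y, W S).

Section FactorIdeal.
Variables (C : preadditive) (W : C -> Prop) (sumW : has_sums W).

Definition factor_pred (A B : C) : {pred hom A B} :=
  [pred f | `[< factors_through W f >]].

Lemma factor_zmod_closed (A B : C) : zmod_closed (@factor_pred A B).
Proof.
have [[X0 WX0] sum2] := sumW.
split=> [|f g].
  by apply/asboolP; exists X0, 0, 0; rewrite mcompm0.
move=> /asboolP[X [p [i [WX ->]]]] /asboolP[Y [q [j [WY ->]]]].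
have [S WS] := sum2 _ _ WX WY; apply/asboolP.
exists S, (inj1 S ∘ p - inj2 S ∘ q), (i ∘ prj1 S + j ∘ prj2 S); split=> //.
rewrite mcompDr mcompNr !mcompDl -!mcompA.
rewrite (mcompA (prj1 S) _ p) (mcompA (prj2 S) _ p).
rewrite (mcompA (prj1 S) _ q) (mcompA (prj2 S) _ q).
rewrite prj1_inj1 prj2_inj2 prj1_inj2 prj2_inj1.
by rewrite !mcomp0m !mcompm0 !mcomp1m addr0 add0r.
Qed.

Definition factor_zmodClosed (A B : C) : zmodClosed (hom A B) :=
  HB.pack (@factor_pred A B)
    (GRing.isZmodClosed.Build (hom A B) (@factor_pred A B)
       (@factor_zmod_closed A B)).

Lemma factor_idealMl (A B D : C) (g : hom B D) (f : hom A B) :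
  f \in factor_zmodClosed A B -> g ∘ f \in factor_zmodClosed A D.
Proof.
move=> /asboolP[X [p [i [WX ->]]]]; apply/asboolP.
by exists X, p, (g ∘ i); rewrite mcompA.
Qed.

Lemma factor_idealMr (A B D : C) (g : hom B D) (f : hom A B) :
  g \in factor_zmodClosed B D -> g ∘ f \in factor_zmodClosed A D.
Proof.
move=> /asboolP[X [p [i [WX ->]]]]; apply/asboolP.
by exists X, (p ∘ f), i; rewrite mcompA.
Qed.

Definition factor_ideal : ideal C := Ideal factor_idealMl factor_idealMr.

End FactorIdeal.

(** * Extriangulated categories *)

Record short_seq (B : preadditive) (A C : B) : Type := ShortSeq {
  mid : B;
  seq_x : hom A mid;
  seq_y : hom mid C }.
Arguments ShortSeq {B A C mid} seq_x seq_y.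

Definition seq_equiv (B : preadditive) (A C : B) (S T : short_seq A C) : Prop :=
  exists b : hom (mid S) (mid T),
    [/\ is_iso b, b ∘ seq_x S = seq_x T & seq_y T ∘ b = seq_y S].

(** [ext C A] is E(C, A), contravariant in [C] and covariant in [A];
    [push a] is a_* and [pull c] is c^*. *)
Record ext_bifunctor (B : preadditive) : Type := ExtBifunctor {
  ext :> B -> B -> zmodType;
  push : forall C A A' : B, hom A A' -> ext C A -> ext C A';
  pull : forall C C' A : B, hom C' C -> ext C A -> ext C' A;
  push1 : forall C A (d : ext C A), push (idm A) d = d;
  pull1 : forall C A (d : ext C A), pull (idm C) d = d;
  push_comp : forall C A A' A'' (a' : hom A' A'') (a : hom A A') (d : ext C A),
    push (a' ∘ a) d = push a' (push a d);
  pull_comp : forall C C' C'' A (c : hom C' C) (c' : hom C'' C') (d : ext C A),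
    pull (c ∘ c') d = pull c' (pull c d);
  push_pull : forall C C' A A' (a : hom A A') (c : hom C' C) (d : ext C A),
    push a (pull c d) = pull c (push a d);
  pushD : forall C A A' (a : hom A A') (d d' : ext C A),
    push a (d + d') = push a d + push a d';
  pullD : forall C C' A (c : hom C' C) (d d' : ext C A),
    pull c (d + d') = pull c d + pull c d';
  push_addm : forall C A A' (a a' : hom A A') (d : ext C A),
    push (a + a') d = push a d + push a' d;
  pull_addm : forall C C' A (c c' : hom C' C) (d : ext C A),
    pull (c + c') d = pull c d + pull c' d }.

(** The element of E(C + C', A + A') corresponding to (d, 0, 0, d'). *)
Definition ext_sum (B : preadditive) (E : ext_bifunctor B) (A A' C C' : B)
    (PA : biproduct A A') (PC : biproduct C C') (d : E C A) (d' : E C' A') :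
    E PC PA :=
  push (inj1 PA) (pull (prj1 PC) d) + push (inj2 PA) (pull (prj2 PC) d').

Definition seq_sum (B : preadditive) (A A' C C' : B)
    (S : short_seq A C) (S' : short_seq A' C')
    (PA : biproduct A A') (PB : biproduct (mid S) (mid S'))
    (PC : biproduct C C') : short_seq PA PC :=
  ShortSeq (bp_map PA PB (seq_x S) (seq_x S'))
           (bp_map PB PC (seq_y S) (seq_y S')).

(** [realizes d S] says that the sequence [S] belongs to the class s(d);
    [realizes_class] says that s(d) is exactly one equivalence class. *)
Record extriangulated : Type := Extriangulated {
  ecat :> preadditive;
  ecat_additive : additive_category ecat;
  E : ext_bifunctor ecat;
  realizes : forall C A : ecat, E C A -> short_seq A C -> Prop;
  realizes_class : forall (C A : ecat) (d : E C A),
    exists S, forall T, realizes d T <-> seq_equiv S T;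
  ET2_morphism : forall (A B C A' B' C' : ecat)
      (x : hom A B) (y : hom B C) (x' : hom A' B') (y' : hom B' C')
      (d : E C A) (d' : E C' A') (a : hom A A') (c : hom C C'),
    realizes d (ShortSeq x y) -> realizes d' (ShortSeq x' y') ->
    push a d = pull c d' ->
    exists b : hom B B', b ∘ x = x' ∘ a /\ y' ∘ b = c ∘ y;
  ET2_split : forall (A C : ecat) (P : biproduct A C),
    realizes (0 : E C A) (ShortSeq (inj1 P) (prj2 P));
  ET2_sum : forall (A A' C C' : ecat) (d : E C A) (d' : E C' A')
      (S : short_seq A C) (S' : short_seq A' C')
      (PA : biproduct A A') (PB : biproduct (mid S) (mid S'))
      (PC : biproduct C C'),
    realizes d S -> realizes d' S' ->
    realizes (ext_sum PA PC d d') (seq_sum PA PB PC);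
  ET3 : forall (A B C A' B' C' : ecat)
      (x : hom A B) (y : hom B C) (x' : hom A' B') (y' : hom B' C')
      (d : E C A) (d' : E C' A') (a : hom A A') (b : hom B B'),
    realizes d (ShortSeq x y) -> realizes d' (ShortSeq x' y') ->
    b ∘ x = x' ∘ a ->
    exists c : hom C C', c ∘ y = y' ∘ b /\ push a d = pull c d';
  ET3op : forall (A B C A' B' C' : ecat)
      (x : hom A B) (y : hom B C) (x' : hom A' B') (y' : hom B' C')
      (d : E C A) (d' : E C' A') (b : hom B B') (c : hom C C'),
    realizes d (ShortSeq x y) -> realizes d' (ShortSeq x' y') ->
    y' ∘ b = c ∘ y ->
    exists a : hom A A', b ∘ x = x' ∘ a /\ push a d = pull c d';
  ET4 : forall (A B C D F : ecat)
      (f : hom A B) (f' : hom B D) (g : hom B C) (g' : hom C F)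
      (d1 : E D A) (d2 : E F B),
    realizes d1 (ShortSeq f f') -> realizes d2 (ShortSeq g g') ->
    exists (X : ecat) (d : hom D X) (e : hom X F) (h' : hom C X) (d3 : E X A),
      [/\ h' ∘ g = d ∘ f' /\ e ∘ h' = g',
          realizes d3 (ShortSeq (g ∘ f) h'),
          realizes (push f' d2) (ShortSeq d e),
          pull d d3 = d1
        & push f d3 = pull e d2];
  ET4op : forall (A B C D F : ecat)
      (f' : hom D B) (f : hom B A) (g' : hom F C) (g : hom C B)
      (d1 : E A D) (d2 : E B F),
    realizes d1 (ShortSeq f' f) -> realizes d2 (ShortSeq g' g) ->
    exists (X : ecat) (d : hom X D) (e : hom F X) (h' : hom X C) (d3 : E A X),
      [/\ g ∘ h' = f' ∘ d /\ h' ∘ e = g',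
          realizes d3 (ShortSeq h' (f ∘ g)),
          realizes (pull f' d2) (ShortSeq e d),
          push d d3 = d1
        & pull f d3 = push e d2] }.

Arguments E {e}.

Section Extriangulated.
Variable B : extriangulated.

Definition conflation (X Y Z : B) (x : hom X Y) (y : hom Y Z) : Prop :=
  exists d : E Z X, realizes d (ShortSeq x y).

Definition Cone (PX PY : B -> Prop) (Z : B) : Prop :=
  exists (X Y : B) (x : hom X Y) (y : hom Y Z),
    [/\ PX X, PY Y & conflation x y].

Definition CoCone (PX PY : B -> Prop) (Z : B) : Prop :=
  exists (X Y : B) (x : hom Z X) (y : hom X Y),
    [/\ PX X, PY Y & conflation x y].

Record cotorsion_pair : Type := CotorsionPair {
  cotU : B -> Prop;
  cotV : B -> Prop;
  cotU_additive : additive_subcategory cotU;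
  cotV_additive : additive_subcategory cotV;
  cotU_iso : iso_closed cotU;
  cotV_iso : iso_closed cotV;
  cotU_summand : summand_closed cotU;
  cotV_summand : summand_closed cotV;
  cot_ext0 : forall U V : B, cotU U -> cotV V -> forall d : E U V, d = 0;
  cot_cone : forall X : B, Cone cotV cotU X;
  cot_cocone : forall X : B, CoCone cotV cotU X }.

Section Heart.
Variable P : cotorsion_pair.

Definition cotW (X : B) : Prop := cotU P X /\ cotV P X.
Definition Bplus : B -> Prop := Cone (cotV P) cotW.
Definition Bminus : B -> Prop := CoCone cotW (cotU P).
Definition cotH (X : B) : Prop := Bplus X /\ Bminus X.

Lemma cotW_sum (X Y : B) (S : biproduct X Y) : cotW X -> cotW Y -> cotW S.
Proof.
move=> [UX VX] [UY VY]; split.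
  exact: (sub_sum (cotU_additive P)).
exact: (sub_sum (cotV_additive P)).
Qed.

Lemma cot_zero : exists Z : B, [/\ is_zero_object Z, cotU P Z & cotV P Z].
Proof.
have [Z z0 UZ] := sub_zero (cotU_additive P).
have [Z' z0' VZ'] := sub_zero (cotV_additive P).
exists Z; split=> //; apply: (cotV_iso (A := Z')) VZ'; exists 0, 0; split.
  by rewrite ((z0' _).1 (idm Z')) mcomp0m.
by rewrite ((z0 _).1 (idm Z)) mcomp0m.
Qed.

(** The split conflations 0 -> W -> W and W -> W -> 0. *)
Lemma cotW_cotH (X : B) : cotW X -> cotH X.
Proof.
move=> [UX VX]; have [Z [z0 UZ VZ]] := cot_zero.
have idZ : idm Z = 0 by exact: (z0 Z).1.
have e1 : (0 : hom X Z) ∘ 0 = idm Z by rewrite mcomp0m idZ.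
have e2 : idm X ∘ idm X = idm X by rewrite mcomp1m.
have e3 : (0 : hom X Z) ∘ idm X = 0 by rewrite mcomp0m.
have e4 : idm X ∘ (0 : hom Z X) = 0 by rewrite mcompm0.
have e5 : (0 : hom Z X) ∘ (0 : hom X Z) + idm X ∘ idm X = idm X.
  by rewrite mcomp0m mcomp1m add0r.
have e6 : idm X ∘ idm X + (0 : hom Z X) ∘ (0 : hom X Z) = idm X.
  by rewrite mcomp0m mcomp1m addr0.
split.
  exists Z, X, 0, (idm X); split=> //; exists 0.
  exact: (ET2_split (Biproduct e1 e2 e3 e4 e5)).
exists X, Z, (idm X), 0; split=> //; exists 0.
exact: (ET2_split (Biproduct e2 e1 e4 e3 e6)).
Qed.

Definition heart_cat : preadditive := full_subcategory cotH.

Definition heartW (X : heart_cat) : Prop := cotW (sval X).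

Lemma heartW_has_sums : has_sums heartW.
Proof.
split=> [|[X HX] [Y HY] WX WY].
  by have [Z [_ UZ VZ]] := cot_zero; exists (exist _ Z (cotW_cotH (conj UZ VZ))).
have [S] := (ecat_additive B).2 X Y; have WS := cotW_sum S WX WY.
by exists (@Biproduct heart_cat (exist _ X HX) (exist _ Y HY)
  (exist _ (bp_obj S) (cotW_cotH WS)) _ _ _ _ (prj1_inj1 S) (prj2_inj2 S)
  (prj1_inj2 S) (prj2_inj1 S) (inj_prjD S)).
Qed.

Definition heart : preadditive :=
  ideal_quotient (factor_ideal heartW_has_sums).

End Heart.
End Extriangulated.

(* Main.v *)
From mathcomp Require Import all_boot all_algebra.
From mathcomp Require Import boolp.
Require Import Defs.

Set Implicit Arguments.
Unset Strict Implicit.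
Unset Printing Implicit Defensive.

Import GRing.Theory.
Local Open Scope ring_scope.
Local Open Scope cat_scope.

(** The two halves of the definition of an abelian category are exchanged by
    passing to the opposite extriangulated category, with the cotorsion pair
    (V, U). It is therefore enough to construct cokernels and to show that
    every epimorphism of the heart is a cokernel. Both are done in B itself,
    for morphisms modulo the ideal [W] of those factoring through W; this
    condition is visibly self-dual.

    Cokernels. For f : X -> Y in H take a conflation X -w-> M -> Z with M in W
    and Z in U. The map (f, w) : X -> Y + M is an inflation; let C be its cone
    ([mapping_cone]). Then Y -> C is an inflation with cone Z, so C is in B^-
    ([Bminus_extension]), and a map g : Y -> D with g f in [W] extends along
    it, because the map through W which g f equals extends along w, as
    E(U, V) = 0. The object C need not be in B^+, but it has a reflection
    C -> Q into B^+ which is again an inflation with cone in U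
    ([Bplus_reflection]), so Q is in H. The composite Y -> C -> Q is the
    cokernel of f in the heart; uniqueness of factorizations is the fact that
    an inflation with cone in U is epi modulo [W] against B^+
    ([inflation_cotU_epi]).

    Epimorphisms. If f is epi in the heart, then Q is zero there, that is, Q is
    a retract of an object of W, which forces C to be in U. Now X -> Y + M -> C
    is a conflation whose third term is in U. Composing Y + M -> C with a
    deflation L -> Y + M, where L is in W and the cocone T is in V, gives by
    (ET4)^op conflations T -> K -> X and K -> L -> C. The second shows that K
    is in B^-, the first that K is in B^+. The class of X -> Y + M -> C is the
    pushforward of the class of K -> L -> C along k : K -> X. If g k is in [W],
    then g k factors through K -> L, since E(C, W) = 0, and so kills the latter
    class; hence g kills the former and extends to Y + M. This makes f a
    cokernel of k in the heart ([heart_epi_cokernel]). *)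

(** * Duality *)

(** Reversing arrows also exchanges the two arguments of E, so that pushforward
    and pullback trade places, and (ET3), (ET4) trade places with their duals.
    The data are kept definitionally the same: a statement about B^op unfolds
    to the dual statement about B by conversion. *)
Definition op_cat (C : preadditive) : preadditive :=
  @Preadditive C (fun X Y => hom Y X) (fun X => idm X) (fun X Y Z g f => f ∘ g)
    (fun X Y Z T h g f => esym (mcompA f g h))
    (fun X Y f => mcompm1 f) (fun X Y f => mcomp1m f)
    (fun X Y Z g g' f => mcompDr f g g') (fun X Y Z g f f' => mcompDl f f' g).

Section OpBiproduct.
Variables (C : preadditive) (X Y : C).

Definition unop_biproduct (S : @biproduct (op_cat C) X Y) : biproduct X Y :=
  @Biproduct C X Y (bp_obj S) (prj1 S) (prj2 S) (inj1 S) (inj2 S)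
    (prj1_inj1 S) (prj2_inj2 S) (prj2_inj1 S) (prj1_inj2 S) (inj_prjD S).

Definition op_biproduct (S : biproduct X Y) : @biproduct (op_cat C) X Y :=
  @Biproduct (op_cat C) X Y (bp_obj S) (prj1 S) (prj2 S) (inj1 S) (inj2 S)
    (prj1_inj1 S) (prj2_inj2 S) (prj2_inj1 S) (prj1_inj2 S) (inj_prjD S).

End OpBiproduct.

Definition swap_biproduct (C : preadditive) (X Y : C) (S : biproduct X Y) :
  biproduct Y X :=
  @Biproduct C Y X (bp_obj S) (inj2 S) (inj1 S) (prj2 S) (prj1 S)
    (prj2_inj2 S) (prj1_inj1 S) (prj2_inj1 S) (prj1_inj2 S)
    (etrans (addrC _ _) (inj_prjD S)).

Lemma op_zero_object (C : preadditive) (Z : C) :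
  is_zero_object Z -> @is_zero_object (op_cat C) Z.
Proof. by move=> z0 X; have [] := z0 X. Qed.

Lemma op_additive_category (C : preadditive) :
  additive_category C -> additive_category (op_cat C).
Proof.
move=> [[Z z0] bp]; split; first by exists Z; exact: op_zero_object.
by move=> X Y; have [S] := bp X Y; exists; exact: op_biproduct S.
Qed.

Definition op_ext (C : preadditive) (F : ext_bifunctor C) :
    ext_bifunctor (op_cat C) :=
  @ExtBifunctor (op_cat C) (fun X Y => F Y X)
    (fun X Y Y' => @pull C F Y Y' X) (fun X X' Y => @push C F Y X X')
    (fun X Y => @pull1 C F Y X) (fun X Y => @push1 C F Y X)
    (fun X Y Y' Y'' a' a d => @pull_comp C F Y Y' Y'' X a a' d)
    (fun X X' X'' Y c c' d => @push_comp C F Y X X' X'' c' c d)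
    (fun X X' Y Y' a c d => esym (@push_pull C F Y Y' X X' c a d))
    (fun X Y Y' => @pullD C F Y Y' X)
    (fun X X' Y => @pushD C F Y X X')
    (fun X Y Y' => @pull_addm C F Y Y' X)
    (fun X X' Y => @push_addm C F Y X X').

Definition op_seq (C : preadditive) (X Z : op_cat C)
    (S : @short_seq (op_cat C) X Z) : @short_seq C Z X :=
  ShortSeq (seq_y S : @hom C Z (mid S)) (seq_x S : @hom C (mid S) X).

Definition unop_seq (C : preadditive) (X Z : C) (S : @short_seq C Z X) :
  @short_seq (op_cat C) X Z :=
  @ShortSeq (op_cat C) X Z (mid S) (seq_y S) (seq_x S).

Lemma seq_equiv_op (C : preadditive) (X Z : C) (S : @short_seq C Z X)
    (T : @short_seq (op_cat C) X Z) :
  seq_equiv S (op_seq T) <-> @seq_equiv (op_cat C) X Z (unop_seq S) T.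
Proof.
case: S T => M x y [N y' x'] /=; split=> -[/= b [[/= b' [bb' b'b]] e1 e2]].
  by exists b'; split; [exists b|rewrite /= -e2 -mcompA b'b mcompm1
    |rewrite /= -e1 mcompA bb' mcomp1m].
by exists b'; split; [exists b|rewrite /= -e2 mcompA b'b mcomp1m
    |rewrite /= -e1 -mcompA bb' mcompm1].
Qed.

Section OpExtriangulated.
Variable B : extriangulated.

Definition op_realizes (Z X : op_cat B) (d : op_ext (@E B) Z X)
  (S : short_seq X Z) : Prop := realizes (d : E X Z) (op_seq S).

Lemma op_realizes_class (Z X : op_cat B) (d : op_ext (@E B) Z X) :
  exists S, forall T, op_realizes d T <-> seq_equiv S T.
Proof.
have [S HS] := realizes_class (d : E X Z).
by exists (unop_seq S) => T; rewrite -seq_equiv_op; exact: HS.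
Qed.

Lemma op_ET2_split (A C : op_cat B) (S : biproduct A C) :
  op_realizes 0 (ShortSeq (inj1 S) (prj2 S)).
Proof. exact: ET2_split (swap_biproduct (unop_biproduct S)). Qed.

Lemma op_ET2_sum (A A' C C' : op_cat B) (d : op_ext (@E B) C A)
    (d' : op_ext (@E B) C' A') (S : short_seq A C) (S' : short_seq A' C')
    (PA : biproduct A A') (PB : biproduct (mid S) (mid S'))
    (PC : biproduct C C') :
  op_realizes d S -> op_realizes d' S' ->
  op_realizes (ext_sum PA PC d d') (seq_sum PA PB PC).
Proof.
move=> r r'.
have := @ET2_sum B C C' A A' d d' (op_seq S) (op_seq S')
  (unop_biproduct PC) (unop_biproduct PB) (unop_biproduct PA) r r'.
rewrite /op_realizes /ext_sum /seq_sum /bp_map /= !push_pull.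
by rewrite /op_seq /= !mcompA.
Qed.

Lemma op_ET2_morphism (A A0 C A' A0' C' : op_cat B)
    (x : hom A A0) (y : hom A0 C) (x' : hom A' A0') (y' : hom A0' C')
    (d : op_ext (@E B) C A) (d' : op_ext (@E B) C' A')
    (a : hom A A') (c : hom C C') :
  op_realizes d (ShortSeq x y) -> op_realizes d' (ShortSeq x' y') ->
  push a d = pull c d' ->
  exists b : hom A0 A0', b ∘ x = x' ∘ a /\ y' ∘ b = c ∘ y.
Proof.
move=> r r' e.
by have [b [e1 e2]] := ET2_morphism r' r (esym e); exists b.
Qed.

Lemma op_ET3 (A A0 C A' A0' C' : op_cat B)
    (x : hom A A0) (y : hom A0 C) (x' : hom A' A0') (y' : hom A0' C')
    (d : op_ext (@E B) C A) (d' : op_ext (@E B) C' A')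
    (a : hom A A') (b : hom A0 A0') :
  op_realizes d (ShortSeq x y) -> op_realizes d' (ShortSeq x' y') ->
  b ∘ x = x' ∘ a ->
  exists c : hom C C', c ∘ y = y' ∘ b /\ push a d = pull c d'.
Proof.
move=> r r' e.
by have [c [e1 e2]] := ET3op r' r e; exists c.
Qed.

Lemma op_ET3op (A A0 C A' A0' C' : op_cat B)
    (x : hom A A0) (y : hom A0 C) (x' : hom A' A0') (y' : hom A0' C')
    (d : op_ext (@E B) C A) (d' : op_ext (@E B) C' A')
    (b : hom A0 A0') (c : hom C C') :
  op_realizes d (ShortSeq x y) -> op_realizes d' (ShortSeq x' y') ->
  y' ∘ b = c ∘ y ->
  exists a : hom A A', b ∘ x = x' ∘ a /\ push a d = pull c d'.
Proof.
move=> r r' e.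
by have [a [e1 e2]] := ET3 r' r e; exists a.
Qed.

Definition op_extri : extriangulated :=
  @Extriangulated (op_cat B) (op_additive_category (ecat_additive B))
    (op_ext (@E B)) op_realizes op_realizes_class
    op_ET2_morphism op_ET2_split op_ET2_sum op_ET3 op_ET3op
    (fun A A0 C D F f f' g g' d1 d2 r1 r2 =>
       @ET4op B A A0 C D F f' f g' g d1 d2 r1 r2)
    (fun A A0 C D F f' f g' g d1 d2 r1 r2 =>
       @ET4 B A A0 C D F f f' g g' d1 d2 r1 r2).

Lemma op_additive_subcategory (Q : B -> Prop) :
  additive_subcategory Q -> @additive_subcategory op_extri Q.
Proof.
move=> [[Z z0 QZ] sumQ]; split; first by exists Z => //; exact: op_zero_object.
by move=> X Y S; exact: (sumQ X Y (unop_biproduct S)).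
Qed.

Lemma op_iso_closed (Q : B -> Prop) : iso_closed Q -> @iso_closed op_extri Q.
Proof.
by move=> isoQ X Y [f [g [gf fg]]]; apply: isoQ; exists g, f.
Qed.

Lemma op_summand_closed (Q : B -> Prop) :
  summand_closed Q -> @summand_closed op_extri Q.
Proof. by move=> sumQ X Y S; exact: (sumQ X Y (unop_biproduct S)). Qed.

Lemma op_Cone (Q R : B -> Prop) (Z : B) :
  @Cone op_extri Q R Z <-> CoCone R Q Z.
Proof.
by split=> -[X [Y [x [y [HX HY [d r]]]]]]; exists Y, X, y, x; split=> //;
  exists d.
Qed.

Lemma op_CoCone (Q R : B -> Prop) (Z : B) :
  @CoCone op_extri Q R Z <-> Cone R Q Z.
Proof.
by split=> -[X [Y [x [y [HX HY [d r]]]]]]; exists Y, X, y, x; split=> //;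
  exists d.
Qed.

Variable P : cotorsion_pair B.

Definition op_cot : cotorsion_pair op_extri :=
  @CotorsionPair op_extri (cotV P) (cotU P)
    (op_additive_subcategory (cotV_additive P))
    (op_additive_subcategory (cotU_additive P))
    (op_iso_closed (cotV_iso (c:=P))) (op_iso_closed (cotU_iso (c:=P)))
    (op_summand_closed (cotV_summand (c:=P)))
    (op_summand_closed (cotU_summand (c:=P)))
    (fun X Y VX UY d => cot_ext0 UY VX d)
    (fun X => (op_Cone _ _ X).2 (cot_cocone P X))
    (fun X => (op_CoCone _ _ X).2 (cot_cone P X)).

Lemma op_cotW (X : B) : cotW op_cot X <-> cotW P X.
Proof. by split=> -[]. Qed.

Lemma op_Bminus (X : B) : Bminus op_cot X <-> Bplus P X.
Proof.
rewrite /Bminus op_CoCone; split=> -[V [W [x [y [VV HW c]]]]];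
  by exists V, W, x, y; split=> //; apply/op_cotW.
Qed.

Lemma op_Bplus (X : B) : Bplus op_cot X <-> Bminus P X.
Proof.
rewrite /Bplus op_Cone; split=> -[V [W [x [y [VV HW c]]]]];
  by exists V, W, x, y; split=> //; apply/op_cotW.
Qed.

Lemma op_cotH (X : B) : cotH op_cot X <-> cotH P X.
Proof. by rewrite /cotH op_Bminus op_Bplus; split=> -[]. Qed.

Lemma op_factors (X Y : B) (f : hom X Y) :
  @factors_through op_extri (cotW op_cot) Y X f <->
  factors_through (cotW P) f.
Proof.
by split=> -[W [g [h [HW ->]]]]; exists W, h, g; split=> //; apply/op_cotW.
Qed.

End OpExtriangulated.

(** * Biproduct calculus *)

Section BiproductCalculus.
Variables (C : preadditive) (X Y : C) (S : biproduct X Y).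

Lemma mcompAr (A1 A2 A3 A4 : C) (h : hom A3 A4) (g : hom A2 A3)
  (f : hom A1 A2) : h ∘ g ∘ f = h ∘ (g ∘ f).
Proof. exact/esym/mcompA. Qed.

Lemma prj1_inj1K (T : C) (f : hom T X) : prj1 S ∘ (inj1 S ∘ f) = f.
Proof. by rewrite mcompA prj1_inj1 mcomp1m. Qed.

Lemma prj2_inj2K (T : C) (f : hom T Y) : prj2 S ∘ (inj2 S ∘ f) = f.
Proof. by rewrite mcompA prj2_inj2 mcomp1m. Qed.

Lemma prj1_inj2K (T : C) (f : hom T Y) : prj1 S ∘ (inj2 S ∘ f) = 0.
Proof. by rewrite mcompA prj1_inj2 mcomp0m. Qed.

Lemma prj2_inj1K (T : C) (f : hom T X) : prj2 S ∘ (inj1 S ∘ f) = 0.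
Proof. by rewrite mcompA prj2_inj1 mcomp0m. Qed.

End BiproductCalculus.

Definition mcompE := (mcompAr, mcompDl, mcompDr, mcompNl, mcompNr).

Definition bpE :=
  (mcompE, prj1_inj1K, prj2_inj2K, prj1_inj2K, prj2_inj1K,
   prj1_inj1, prj2_inj2, prj1_inj2, prj2_inj1,
   mcomp0m, mcompm0, mcomp1m, mcompm1, addr0, add0r, oppr0).

Section ZeroBiproduct.
Variables (C : preadditive) (X Z : C) (z0 : is_zero_object Z).

Let idZ : (0 : hom X Z) ∘ (0 : hom Z X) = idm Z.
Proof. by rewrite mcomp0m ((z0 Z).1 (idm Z)). Qed.

Let idX : idm X ∘ idm X + (0 : hom Z X) ∘ (0 : hom X Z) = idm X.
Proof. by rewrite mcomp0m mcomp1m addr0. Qed.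

Definition zero_biproduct : biproduct X Z :=
  Biproduct (mcomp1m (idm X)) idZ (mcomp1m 0) (mcompm1 0) idX.

End ZeroBiproduct.

Section GraphBiproduct.
Variables (C : preadditive) (X Y : C) (S : biproduct Y X) (f : hom X Y).

Let gi := inj1 S ∘ f + inj2 S.
Let gp := prj1 S - f ∘ prj2 S.

Let prj2_gi : prj2 S ∘ gi = idm X. Proof. by rewrite /gi !bpE. Qed.
Let gp_inj1 : gp ∘ inj1 S = idm Y. Proof. by rewrite /gp !bpE. Qed.
Let prj2_inj1S : prj2 S ∘ inj1 S = 0. Proof. by rewrite !bpE. Qed.
Let gp_gi : gp ∘ gi = 0.
Proof. by rewrite /gi /gp !bpE subrr. Qed.
Let gi_gpD : gi ∘ prj2 S + inj1 S ∘ gp = idm S.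
Proof.
by rewrite /gi /gp -(inj_prjD S) !mcompE addrC addrA addrNK.
Qed.

(** The decomposition of Y + X as the graph of f plus Y: the complementary
    projection to Y is (y, x) |-> y - f x. *)
Definition graph_biproduct : biproduct X Y :=
  Biproduct prj2_gi gp_inj1 prj2_inj1S gp_gi gi_gpD.

End GraphBiproduct.

(** * Exact sequences of a conflation *)

Section ExtZero.
Variables (B : preadditive) (F : ext_bifunctor B) (X X' Y Y' : B).

Lemma push0 (a : hom Y Y') : push a (0 : F X Y) = 0.
Proof. by apply: (addIr (push a 0)); rewrite -pushD !add0r. Qed.

Lemma pull0 (c : hom X' X) : pull c (0 : F X Y) = 0.
Proof. by apply: (addIr (pull c 0)); rewrite -pullD !add0r. Qed.

End ExtZero.

Section Realization.
Variable B : extriangulated.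

Lemma realizes_exists (Z X : B) (d : E Z X) :
  exists (Y : B) (x : hom X Y) (y : hom Y Z), realizes d (ShortSeq x y).
Proof.
have [[Y x y] HS] := realizes_class d; exists Y, x, y; apply/HS.
exists (idm Y); split; rewrite ?mcomp1m ?mcompm1 //.
by exists (idm Y); rewrite mcomp1m.
Qed.

Lemma realizes_iso (Z X Y Y' : B) (d : E Z X) (x : hom X Y) (y : hom Y Z)
    (x' : hom X Y') (y' : hom Y' Z) :
  realizes d (ShortSeq x y) -> realizes d (ShortSeq x' y') -> isomorphic Y Y'.
Proof.
have [S HS] := realizes_class d.
move=> /HS[/= b [[b' [b'b bb']] _ _]] /HS[/= c [[c' [c'c cc']] _ _]].
exists (c ∘ b'), (b ∘ c'); split.
  by rewrite mcompA -(mcompA b) c'c mcompm1.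
by rewrite mcompA -(mcompA c) b'b mcompm1.
Qed.

Lemma realizes_id (X Z : B) :
  is_zero_object Z -> realizes (0 : E Z X) (ShortSeq (idm X) (0 : hom X Z)).
Proof. by move=> z0; exact: ET2_split (zero_biproduct X z0). Qed.

Section Conflation.
Variables (X Y Z : B) (x : hom X Y) (y : hom Y Z) (d : E Z X).
Hypothesis r : realizes d (ShortSeq x y).

(** The four lemmas below come from comparing the conflation with the trivial
    ones T -> T -> 0 and 0 -> T -> T by (ET2) and (ET3). *)
Lemma conflation_comp0 : y ∘ x = 0.
Proof.
have [O z0] := (ecat_additive B).1.
have [c [<- _]] := ET3 (realizes_id X z0) r (erefl (x ∘ idm X)).
by rewrite mcompm0.
Qed.

Lemma conflation_push0 : push x d = 0.
Proof.
have [O z0] := (ecat_additive B).1.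
have [c [_ ->]] := ET3 r (realizes_id Y z0) (erefl (idm Y ∘ x)).
by rewrite pull0.
Qed.

Lemma conflation_colift (T : B) (g : hom Y T) :
  g ∘ x = 0 -> exists u : hom Z T, g = u ∘ y.
Proof.
move=> gx; have [O z0] := (ecat_additive B).1.
have rT : realizes (0 : E T O) (ShortSeq (0 : hom O T) (idm T)).
  exact: ET2_split (swap_biproduct (zero_biproduct T z0)).
have e : g ∘ x = (0 : hom O T) ∘ (0 : hom X O) by rewrite gx mcompm0.
by have [c [ec _]] := ET3 r rT e; exists c; rewrite ec mcomp1m.
Qed.

Lemma conflation_extend (T : B) (g : hom X T) :
  push g d = 0 -> exists u : hom Y T, u ∘ x = g.
Proof.
move=> gd; have [O z0] := (ecat_additive B).1.
have e : push g d = pull (0 : hom Z O) 0 by rewrite gd pull0.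
have [b [eb _]] := ET2_morphism r (realizes_id T z0) e.
by exists b; rewrite eb mcomp1m.
Qed.

(** Exactness of E(Z, T) -> E(Y, T) -> E(X, T) in the middle. Realize e as
    T -> M -> Y; by (ET4)^op the composite M -> Y -> Z is a deflation whose
    cocone N is the middle term of a realization of x^* e. If x^* e = 0, then T -> N has a retraction t,
    and pushing the class of N -> M -> Z along t gives e'. *)
Lemma pull_exact (T : B) (e : E Y T) :
  pull x e = 0 -> exists e' : E Z T, e = pull y e'.
Proof.
move=> xe; have [M [v [p rM]]] := realizes_exists e.
have [N [n [i [m [d3 [[_ _] _ rN _ e3]]]]]] := ET4op r rM.
rewrite xe in rN.
have [t ti] : exists t : hom N T, t ∘ i = idm T.
  have [O z0] := (ecat_additive B).1.
  have h0 : push (idm T) (0 : E X T) = pull (0 : hom X O) 0.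
    by rewrite push0 pull0.
  have [b [bi _]] := ET2_morphism rN (realizes_id T z0) h0.
  by exists b; rewrite bi mcomp1m.
by exists (push t d3); rewrite -push_pull e3 -push_comp ti push1.
Qed.

End Conflation.

End Realization.

Section DualConflation.
Variables (B : extriangulated) (X Y Z : B).
Variables (x : hom X Y) (y : hom Y Z) (d : E Z X).
Hypothesis r : realizes d (ShortSeq x y).

Lemma conflation_lift (T : B) (g : hom T Z) :
  pull g d = 0 -> exists u : hom T Y, y ∘ u = g.
Proof. exact: (@conflation_extend (op_extri B) Z Y X y x d r). Qed.

End DualConflation.

Lemma realizes_conflation (B : extriangulated) (X Y Z : B) (d : E Z X)
    (x : hom X Y) (y : hom Y Z) :
  realizes d (ShortSeq x y) -> conflation x y.
Proof. by exists d. Qed.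

(** The map (f, w) is the inclusion of the graph of f into Y + X, an inflation
    with cone Y, followed by 1 + w, an inflation with cone T; (ET4) composes
    the two. The cone C serves as a first approximation to the cokernel of f:
    it kills f up to morphisms through the object W, and Y -> C is itself an
    inflation. *)

Lemma mapping_cone (B : extriangulated) (X Y W T : B) (S : biproduct Y W)
    (f : hom X Y) (w : hom X W) (u : hom W T) :
  conflation w u ->
  exists (C : B) (h : hom S C) (e : hom C T),
    conflation (inj1 S ∘ f + inj2 S ∘ w) h /\ conflation (h ∘ inj1 S) e.
Proof.
move=> [d r]; have [O z0] := (ecat_additive B).1.
have [R] := (ecat_additive B).2 Y X.
have r1 := @ET2_sum B Y X O T 0 d (ShortSeq (idm Y) 0) (ShortSeq w u) R S
  (swap_biproduct (zero_biproduct T z0))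
  (realizes_id Y z0) r.
have r2 := ET2_split (graph_biproduct R f).
have [C [c [e [h [d3 [[hc _] r3 r4 _ _]]]]]] := ET4 r2 r1.
exists C, h, e; split.
  exists d3; move: r3; rewrite /= /bp_map; congr (realizes _ (ShortSeq _ _)).
  by rewrite !bpE.
have -> : h ∘ inj1 S = c; last exact: realizes_conflation r4.
by have := congr1 (fun m => m ∘ inj1 R) hc; rewrite /= /bp_map !bpE.
Qed.

(** * Cotorsion pairs *)

Section Cotorsion.
Variables (B : extriangulated) (P : cotorsion_pair B).

Local Notation U := (cotU P).
Local Notation V := (cotV P).
Local Notation W := (cotW P).

(** Since E(X, V_X) = 0, the conflation V_X -> U_X -> X is isomorphic to
    V_X -> V_X + X -> X. This gives X a complement in U_X; a mere retraction
    U_X -> X would not, as idempotents need not split in B. *)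
Lemma cotU_perp (X : B) : (forall T, V T -> forall d : E X T, d = 0) -> U X.
Proof.
move=> X0; have [T [Y [t [y [VT UY [d r]]]]]] := cot_cone P X.
have [S] := (ecat_additive B).2 T X.
rewrite (X0 T VT d) in r.
have US : U S by apply: (cotU_iso (realizes_iso r (ET2_split S)) UY).
by have [] := cotU_summand US.
Qed.

Lemma cotU_retract (X Y : B) (i : hom X Y) (p : hom Y X) :
  p ∘ i = idm X -> U Y -> U X.
Proof.
move=> pi UY; apply: cotU_perp => T VT d.
by rewrite -[d]pull1 -pi pull_comp (cot_ext0 UY VT (pull _ _)) pull0.
Qed.

Lemma cotU_extension (X Y Z : B) (x : hom X Y) (y : hom Y Z) :
  conflation x y -> U X -> U Z -> U Y.
Proof.
move=> [d r] UX UZ; apply: cotU_perp => T VT e.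
have [e' ->] := pull_exact r (cot_ext0 UX VT (pull x e)).
by rewrite (cot_ext0 UZ VT e') pull0.
Qed.

Lemma extend_into_cotV (X Y Z T : B) (x : hom X Y) (y : hom Y Z) (g : hom X T) :
  conflation x y -> U Z -> V T -> exists u : hom Y T, u ∘ x = g.
Proof.
move=> [d r] UZ VT.
exact: (conflation_extend r (cot_ext0 UZ VT (push g d))).
Qed.

(** The approximation Y -> V^Y -> U^Y already has its middle term in U. The
    composite X -> Y -> V^Y is an inflation whose cone M is an extension of
    objects of U, so E(V^Y, T) embeds into E(X, T) for T in V; but it maps to
    zero there, because X -> V^Y factors through an object of W. *)
Lemma Bminus_extension (X Y Z : B) (x : hom X Y) (y : hom Y Z) :
  conflation x y -> Bminus P X -> U Z -> Bminus P Y.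
Proof.
move=> c [X1 [X2 [x1 [x2 [[UX1 _] UX2 cX]]]]] UZ.
have [Y1 [Y2 [y1 [y2 [VY1 UY2 cY]]]]] := cot_cocone P Y.
exists Y1, Y2, y1, y2; split=> //; split=> //.
have [[d r] [dY rY]] := (c, cY).
have [M [m1 [m2 [q [d3 [[_ _] rM rZ _ _]]]]]] := ET4 r rY.
have UM : U M by apply: (cotU_extension (realizes_conflation rZ)).
apply: cotU_perp => T VT e.
have [t et] := extend_into_cotV (y1 ∘ x) cX UX2 VY1.
have e0 : pull (y1 ∘ x) e = 0.
  by rewrite -et pull_comp (cot_ext0 UX1 VT (pull _ _)) pull0.
have [e' ->] := pull_exact rM e0.
by rewrite (cot_ext0 UM VT e') pull0.
Qed.

(** * Morphisms factoring through W *)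

Definition inW (X Y : B) (f : hom X Y) : Prop := factors_through W f.

Lemma cotW_has_sums : has_sums W.
Proof.
split=> [|X Y WX WY].
  by have [Z [_ UZ VZ]] := cot_zero P; exists Z.
by have [S] := (ecat_additive B).2 X Y; exists S; exact: cotW_sum.
Qed.

Lemma inWB (X Y : B) (f g : hom X Y) : inW f -> inW g -> inW (f - g).
Proof.
move=> Wf Wg; apply/asboolP.
by apply: (factor_zmod_closed cotW_has_sums X Y).2; apply/asboolP.
Qed.

Lemma inW0 (X Y : B) : inW (0 : hom X Y).
Proof. by apply/asboolP; exact: (factor_zmod_closed cotW_has_sums X Y).1. Qed.

Lemma inWN (X Y : B) (f : hom X Y) : inW f -> inW (- f).
Proof. by move=> Wf; rewrite -sub0r; apply: inWB => //; exact: inW0. Qed.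

Lemma inWD (X Y : B) (f g : hom X Y) : inW f -> inW g -> inW (f + g).
Proof. by move=> Wf Wg; rewrite -[g]opprK; apply/inWB/inWN. Qed.

Lemma inW_compl (X Y Z : B) (g : hom Y Z) (f : hom X Y) : inW f -> inW (g ∘ f).
Proof. by move=> [T [p [i [WT ->]]]]; exists T, p, (g ∘ i); rewrite mcompA. Qed.

Lemma inW_compr (X Y Z : B) (g : hom Y Z) (f : hom X Y) : inW g -> inW (g ∘ f).
Proof. by move=> [T [p [i [WT ->]]]]; exists T, (p ∘ f), i; rewrite mcompA. Qed.

Lemma cone_inW (X Y M C : B) (S : biproduct Y M) (f : hom X Y) (w : hom X M)
    (h : hom S C) :
  W M -> h ∘ (inj1 S ∘ f + inj2 S ∘ w) = 0 -> inW (h ∘ inj1 S ∘ f).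
Proof.
move=> WM; rewrite mcompDr !mcompA => /eqP; rewrite addr_eq0 => /eqP ->.
by apply: inWN; exists M, w, (h ∘ inj2 S).
Qed.

(** The deflation W_Y -> Y has its cocone in V, so f lifts to W_Y. *)
Lemma Bplus_inW (X Y : B) (f : hom X Y) : U X -> Bplus P Y -> inW f.
Proof.
move=> UX [T [M [t [m [VT WM [d r]]]]]].
have [u <-] := conflation_lift r (cot_ext0 UX VT (pull f d)).
by exists M, u, m.
Qed.

(** Subtracting from h the extension to Y of the given factorization of h x
    leaves a map that factors through Z, and Z is in U. *)
Lemma inflation_cotU_epi (X Y Z D : B) (x : hom X Y) (y : hom Y Z)
    (h : hom Y D) :
  conflation x y -> U Z -> Bplus P D -> inW (h ∘ x) -> inW h.
Proof.
move=> c UZ BD [M [p [i [[UM VM] hx]]]].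
have [p' ep] := extend_into_cotV p c UZ VM.
have hx0 : (h - i ∘ p') ∘ x = 0 by rewrite !mcompE ep hx subrr.
have [d r] := c; have [s es] := conflation_colift r hx0.
rewrite -(subrK (i ∘ p') h) es; apply: inWD.
  by apply/inW_compr/Bplus_inW.
by exists M, p', i.
Qed.

(** Start from V_X -> U_X -> X and replace U_X by the middle term M of a
    conflation U_X -> M -> Z with Z in U and M in V; M is in W, since U is
    closed under extensions. By (ET4) this moves X to X' with M -> X' a
    deflation with cocone V_X. A map g from X to an object D of B^+ extends to
    X' because the obstruction lies in the image of E(Z, U_X), and on U_X the
    map g factors through W. The last clause holds because V_X -> U_X -> X is a
    pullback of the conflation ending in X', which splits if X' is in U. *)
Lemma Bplus_reflection (X : B) :
  exists (X' Z : B) (r : hom X X') (s : hom X' Z),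
    [/\ conflation r s, U Z, Bplus P X',
        forall (D : B) (g : hom X D), Bplus P D ->
          exists u : hom X' D, u ∘ r = g
      & U X' -> U X].
Proof.
have [T [Y [t [y [VT UY [d r]]]]]] := cot_cone P X.
have [M [Z [m [z [VM UZ cM]]]]] := cot_cocone P Y.
have UM := cotU_extension cM UY UZ.
have [e rM] := cM.
have [X' [f [s [h [d3 [[_ _] r3 rX' fd3 _]]]]]] := ET4 r rM.
exists X', Z, f, s; split=> //; first exact: realizes_conflation rX'.
- by exists T, M, (m ∘ t), h; split=> //; exists d3.
- move=> D g [TD [WD [td [wd [VTD [UWD VWD] [dD rD]]]]]].
  apply: (conflation_extend rX'); rewrite -push_comp.
  have [k <-] := conflation_lift rD (cot_ext0 UY VTD (pull (g ∘ y) dD)).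
  by rewrite push_comp (cot_ext0 UZ VWD (push _ _)) push0.
move=> UX'; have d0 : pull (idm X) d = 0.
  by rewrite pull1 -fd3 (cot_ext0 UX' VT d3) pull0.
have [i yi] := conflation_lift r d0.
exact: cotU_retract yi UY.
Qed.

Lemma Bminus_sum (X Y : B) (S : biproduct X Y) :
  Bminus P X -> Bminus P Y -> Bminus P S.
Proof.
move=> [X1 [X2 [x1 [x2 [WX1 UX2 [dX rX]]]]]].
move=> [Y1 [Y2 [y1 [y2 [WY1 UY2 [dY rY]]]]]].
have [S1] := (ecat_additive B).2 X1 Y1; have [S2] := (ecat_additive B).2 X2 Y2.
exists S1, S2, (bp_map S S1 x1 y1), (bp_map S1 S2 x2 y2); split.
- exact: cotW_sum.
- exact: (sub_sum (cotU_additive P)).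
exists (ext_sum S S2 dX dY).
exact: (@ET2_sum B _ _ _ _ dX dY (ShortSeq x1 x2) (ShortSeq y1 y2) S S1 S2).
Qed.

(** * Cokernels modulo W *)

(** Factorizations exist on the nose, while the uniqueness is modulo [W]. *)
Lemma heart_cokernel (X Y : B) (f : hom X Y) : cotH P X -> cotH P Y ->
  exists (Q : B) (q : hom Y Q),
    [/\ cotH P Q, inW (q ∘ f),
        forall (D : B) (g : hom Y D), cotH P D -> inW (g ∘ f) ->
          exists u : hom Q D, u ∘ q = g
      & forall (D : B) (u : hom Q D), cotH P D -> inW (u ∘ q) -> inW u].
Proof.
move=> [_ [M [Z [w [z [WM UZ cX]]]]]] [_ mY].
have [S] := (ecat_additive B).2 Y M.
have [C [h [e [[d1 rh] ce]]]] := mapping_cone S f cX.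
have [Q [Z' [r [s [cr UZ' pQ extQ _]]]]] := Bplus_reflection C.
have mC : Bminus P C by apply: (Bminus_extension ce).
have mQ : Bminus P Q by apply: (Bminus_extension cr).
exists Q, (r ∘ (h ∘ inj1 S)); split=> //.
- by rewrite -mcompA; apply/inW_compl/(cone_inW WM (conflation_comp0 rh)).
- move=> D g [pD _] [N [p [i [[UN VN] gf]]]].
  have [p' ep] := extend_into_cotV p cX UZ VN.
  (* g and a factorization of g f through M agree on X, so (g, - i p')
     descends to the cone C. *)
  have h0 : (g ∘ prj1 S - i ∘ p' ∘ prj2 S) ∘ (inj1 S ∘ f + inj2 S ∘ w) = 0.
    by rewrite !bpE ep gf subrr.
  have [u eu] := conflation_colift rh h0.
  have [v ev] := extQ D u pD; exists v.
  by rewrite !mcompA ev -eu !bpE.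
move=> D u [pD _]; rewrite mcompA => /(inflation_cotU_epi ce UZ pD).
exact: (inflation_cotU_epi cr UZ' pD).
Qed.

End Cotorsion.

Section CotorsionDual.
Variables (B : extriangulated) (P : cotorsion_pair B).

Lemma Bplus_coextension (X Y Z : B) (x : hom X Y) (y : hom Y Z) :
  conflation x y -> cotV P X -> Bplus P Z -> Bplus P Y.
Proof.
move=> [d r] VX /op_Bminus pZ; apply/op_Bminus.
by apply: (@Bminus_extension _ (op_cot P) Z Y X y x); first exists d.
Qed.

Lemma Bplus_sum (X Y : B) (S : biproduct X Y) :
  Bplus P X -> Bplus P Y -> Bplus P S.
Proof.
move=> /op_Bminus pX /op_Bminus pY; apply/op_Bminus.
exact: (@Bminus_sum _ (op_cot P) X Y (op_biproduct S)).
Qed.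

End CotorsionDual.

Section HeartEpi.
Variables (B : extriangulated) (P : cotorsion_pair B).

Lemma cotH_sum (X Y : B) (S : biproduct X Y) :
  cotH P X -> cotH P Y -> cotH P S.
Proof.
by move=> [pX mX] [pY mY]; split; [apply: Bplus_sum | apply: Bminus_sum].
Qed.

(** The construction takes place with X -> Y + M in place of f; these agree in
    the heart, where M is zero. *)
Lemma heart_epi_cokernel (X Y : B) (f : hom X Y) : cotH P X -> cotH P Y ->
  (forall (D : B) (u : hom Y D), cotH P D -> inW P (u ∘ f) -> inW P u) ->
  exists (K : B) (k : hom K X),
    [/\ cotH P K, inW P (f ∘ k)
      & forall (D : B) (g : hom X D), inW P (g ∘ k) ->
          exists u : hom Y D, inW P (u ∘ f - g)].
Proof.
move=> [pX [M [Z [w [z [WM UZ cX]]]]]] [pY mY] epif.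
have [S] := (ecat_additive B).2 Y M.
have [C [h [e [[d1 rh] ce]]]] := mapping_cone S f cX.
have [Q [Z' [r [s [cr UZ' pQ _ UQC]]]]] := Bplus_reflection P C.
have mC : Bminus P C by apply: (Bminus_extension ce).
have mQ : Bminus P Q by apply: (Bminus_extension cr).
have Wf : inW P (r ∘ (h ∘ inj1 S) ∘ f).
  by rewrite -mcompA; apply/inW_compl/(cone_inW WM (conflation_comp0 rh)).
(* The cokernel of f is zero in the heart, hence C is in U. *)
have /(inflation_cotU_epi ce UZ pQ)Wr : inW P (r ∘ (h ∘ inj1 S)).
  by apply: epif.
rewrite -(mcomp1m r) in Wr.
have [N [p [i [[UN VN] pi]]]] := inflation_cotU_epi cr UZ' pQ Wr.
have UC : cotU P C by apply/UQC/(cotU_retract (esym pi)).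
have pS : Bplus P S by apply: Bplus_sum => //; have [] := cotW_cotH WM.
(* K is the homotopy pullback of X -> Y + M along L -> Y + M. *)
have [T [L [t [l [VT [UL VL] [d2 rl]]]]]] := pS.
have [K [k [j [m [d3 [[fk kj] rK rV dk _]]]]]] := ET4op rh rl.
exists K, k; split.
- split; last by exists L, C, m, (h ∘ l); split=> //; exists d3.
  by apply: (Bplus_coextension (realizes_conflation rV)).
- have -> : f ∘ k = prj1 S ∘ l ∘ m by rewrite -mcompA fk !bpE.
  by exists L, m, (prj1 S ∘ l).
move=> D g [N' [p' [i' [[UN' VN'] gk]]]].
have [n en] := extend_into_cotV p' (realizes_conflation rK) UC VN'.
(* d1 = k_* d3, and g k extends to L. *)
have g0 : push g d1 = 0.
  by rewrite -dk -push_comp gk -en !push_comp (conflation_push0 rK) !push0.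
have [u eu] := conflation_extend rh g0.
exists (u ∘ inj1 S); rewrite -eu !mcompE opprD addNKr.
by apply: inWN; exists M, w, (u ∘ inj2 S); rewrite mcompA.
Qed.

End HeartEpi.

Section HeartDual.
Variables (B : extriangulated) (P : cotorsion_pair B).

Lemma heart_kernel (X Y : B) (f : hom X Y) : cotH P X -> cotH P Y ->
  exists (K : B) (k : hom K X),
    [/\ cotH P K, inW P (f ∘ k),
        forall (D : B) (g : hom D X), cotH P D -> inW P (f ∘ g) ->
          exists u : hom D K, k ∘ u = g
      & forall (D : B) (u : hom D K), cotH P D -> inW P (k ∘ u) -> inW P u].
Proof.
move=> /op_cotH HX /op_cotH HY.
have [K [k [HK fk fac uniq]]] := @heart_cokernel _ (op_cot P) Y X f HY HX.
exists K, k; split; first exact/op_cotH.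
- exact/op_factors.
- move=> D g /op_cotH HD fg; apply: fac => //.
  exact/op_factors.
by move=> D u /op_cotH HD ku; apply/op_factors/uniq => //; apply/op_factors.
Qed.

Lemma heart_mono_kernel (X Y : B) (f : hom X Y) : cotH P X -> cotH P Y ->
  (forall (D : B) (u : hom D X), cotH P D -> inW P (f ∘ u) -> inW P u) ->
  exists (Q : B) (q : hom Y Q),
    [/\ cotH P Q, inW P (q ∘ f)
      & forall (D : B) (g : hom D Y), inW P (q ∘ g) ->
          exists u : hom D X, inW P (f ∘ u - g)].
Proof.
move=> /op_cotH HX /op_cotH HY mf.
have [|Q [q [HQ qf fac]]] := @heart_epi_cokernel _ (op_cot P) Y X f HY HX.
  move=> D u /op_cotH HD fu; apply/op_factors/mf => //.
  exact/op_factors.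
exists Q, q; split; first exact/op_cotH.
- exact/op_factors.
move=> D g qg; have [|u fu] := fac D g; first exact/op_factors.
by exists u; apply/op_factors.
Qed.

End HeartDual.

(** * The heart *)

Section Heart.
Variables (B : extriangulated) (P : cotorsion_pair B).

Definition heart_class (X Y : heart P)
  (f : @hom B (sval X) (sval Y)) : @hom (heart P) X Y :=
  @qclass (heart_cat P) (factor_ideal (heartW_has_sums P)) X Y f.

Local Notation hc := (@heart_class _ _).

Lemma heart_classP (X Y : heart P) (f : @hom (heart P) X Y) :
  exists f0, f = hc f0.
Proof. by exists (repr f); rewrite /heart_class qclass_repr. Qed.

Lemma heart_class_comp (X Y Z : heart P) (g : @hom B (sval Y) (sval Z))
  (f : @hom B (sval X) (sval Y)) : hc g ∘ hc f = hc (g ∘ f).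
Proof. exact: qcompE. Qed.

Lemma heart_class_eq (X Y : heart P) (f g : @hom B (sval X) (sval Y)) :
  hc f = hc g <-> inW P (f - g).
Proof.
rewrite /heart_class qclass_eq; split=> [/asboolP|] [T [p [i [WT e]]]].
  by exists (sval T), p, i.
by apply/asboolP; exists (exist _ T (cotW_cotH WT)), p, i.
Qed.

Lemma heart_class_add (X Y : heart P) (f g : @hom B (sval X) (sval Y)) :
  hc (f + g) = hc f + hc g.
Proof. exact: qclassD. Qed.

Lemma heart_class_zero (X Y : heart P) : hc 0 = 0 :> @hom (heart P) X Y.
Proof. by apply: (addIr (hc 0)); rewrite -heart_class_add !add0r. Qed.

Lemma heart_class_eq0 (X Y : heart P) (f : @hom B (sval X) (sval Y)) :
  hc f = 0 <-> inW P f.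
Proof. by rewrite -heart_class_zero heart_class_eq subr0. Qed.

Lemma heart_additive : additive_category (heart P).
Proof.
split.
  have [Z [z0 UZ VZ]] := cot_zero P.
  exists (exist _ Z (cotW_cotH (conj UZ VZ))) => X.
  split=> f; have [f0 ->] := heart_classP f.
    by rewrite ((z0 _).1 f0) heart_class_zero.
  by rewrite ((z0 _).2 f0) heart_class_zero.
move=> X Y; have [S] := (ecat_additive B).2 (sval X) (sval Y).
pose T : heart P := exist _ (bp_obj S) (cotH_sum S (svalP X) (svalP Y)).
exists; apply: (@Biproduct (heart P) X Y T (@heart_class X T (inj1 S))
  (@heart_class Y T (inj2 S)) (@heart_class T X (prj1 S))
  (@heart_class T Y (prj2 S))); rewrite !heart_class_comp.
- by rewrite prj1_inj1.
- by rewrite prj2_inj2.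
- by rewrite prj1_inj2 heart_class_zero.
- by rewrite prj2_inj1 heart_class_zero.
by rewrite -heart_class_add inj_prjD.
Qed.

Lemma heart_has_kernel (X Y : heart P) (f : hom X Y) :
  exists (K : heart P) (k : hom K X), is_kernel f k.
Proof.
have [f0 ->] := heart_classP f.
have [K [k [HK fk fac uniq]]] := heart_kernel f0 (svalP X) (svalP Y).
exists (exist _ K HK), (@heart_class (exist _ K HK) X k); split.
  by rewrite heart_class_comp heart_class_eq0.
move=> D g; have [g0 ->] := heart_classP g.
rewrite heart_class_comp heart_class_eq0 => /(fac _ _ (svalP D))[u ku].
exists (@heart_class D (exist _ K HK) u); split.
  by rewrite heart_class_comp ku.
move=> u'; have [v ->] := heart_classP u'.
rewrite heart_class_comp -ku => /heart_class_eq kv.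
apply/heart_class_eq; rewrite -opprB; apply/inWN/uniq; first exact: svalP D.
by rewrite mcompDr mcompNr.
Qed.

Lemma heart_has_cokernel (X Y : heart P) (f : hom X Y) :
  exists (Q : heart P) (q : hom Y Q), is_cokernel f q.
Proof.
have [f0 ->] := heart_classP f.
have [Q [q [HQ qf fac uniq]]] := heart_cokernel f0 (svalP X) (svalP Y).
exists (exist _ Q HQ), (@heart_class Y (exist _ Q HQ) q); split.
  by rewrite heart_class_comp heart_class_eq0.
move=> D g; have [g0 ->] := heart_classP g.
rewrite heart_class_comp heart_class_eq0 => /(fac _ _ (svalP D))[u uq].
exists (@heart_class (exist _ Q HQ) D u); split.
  by rewrite heart_class_comp uq.
move=> u'; have [v ->] := heart_classP u'.
rewrite heart_class_comp -uq => /heart_class_eq vq.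
apply/heart_class_eq; rewrite -opprB; apply/inWN/uniq; first exact: svalP D.
by rewrite mcompDl mcompNl.
Qed.

Lemma heart_mono_is_kernel (X Y : heart P) (f : hom X Y) : mono f ->
  exists (Q : heart P) (q : hom Y Q), is_kernel q f.
Proof.
have [f0 ->] := heart_classP f; move=> mf.
have [|Q [q [HQ qf fac]]] := heart_mono_kernel (f := f0) (svalP X) (svalP Y).
  move=> D u HD fu.
  suff: @heart_class (exist _ D HD) X u = 0 by rewrite heart_class_eq0.
  by apply: mf; rewrite mcompm0 heart_class_comp heart_class_eq0.
exists (exist _ Q HQ), (@heart_class Y (exist _ Q HQ) q); split.
  by rewrite heart_class_comp heart_class_eq0.
move=> D g; have [g0 ->] := heart_classP g.
rewrite heart_class_comp heart_class_eq0 => /fac[u fu].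
exists (@heart_class D X u); split.
  by rewrite heart_class_comp heart_class_eq.
by move=> u' e; apply: mf; rewrite e heart_class_comp heart_class_eq.
Qed.

Lemma heart_epi_is_cokernel (X Y : heart P) (f : hom X Y) : epi f ->
  exists (K : heart P) (k : hom K X), is_cokernel k f.
Proof.
have [f0 ->] := heart_classP f; move=> ef.
have [|K [k [HK fk fac]]] := heart_epi_cokernel (f := f0) (svalP X) (svalP Y).
  move=> D u HD uf.
  suff: @heart_class Y (exist _ D HD) u = 0 by rewrite heart_class_eq0.
  by apply: ef; rewrite mcomp0m heart_class_comp heart_class_eq0.
exists (exist _ K HK), (@heart_class (exist _ K HK) X k); split.
  by rewrite heart_class_comp heart_class_eq0.
move=> D g; have [g0 ->] := heart_classP g.
rewrite heart_class_comp heart_class_eq0 => /fac[u uf].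
exists (@heart_class Y D u); split.
  by rewrite heart_class_comp heart_class_eq.
by move=> u' e; apply: ef; rewrite e heart_class_comp heart_class_eq.
Qed.

End Heart.

Theorem theorem3p2 (B : extriangulated) (P : cotorsion_pair B) :
  abelian_category (heart P).
Proof.
split; [exact: heart_additive | exact: heart_has_kernel |
  exact: heart_has_cokernel | exact: heart_mono_is_kernel |
  exact: heart_epi_is_cokernel].
Qed.
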